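(* Let $G$ be a tree with $n'$ non-leaf vertices, and for $k\ge2$ let $p_k=n_k/n'$ be the concentration of degree-$k$ vertices among the non-leaf vertices, where $n_k$ is the number of vertices of degree $k$. For sufficiently large $n'$, if \[ p_4+2p_5+3p_6+\cdots\ >\ \frac13, \] then $G$ is well-burnable. In particular, this holds if for some $k\ge4$ the concentration of vertices of degree at least $k$ among the non-leaf vertices exceeds $\frac{1}{3(k-3)}$.
   Context: Burning process on a graph $G$: in round 1 one vertex is chosen and set on fire; in each subsequent round, first every burning vertex sets all its neighbours on fire, then one new vertex is chosen and set on fire; the process ends when all vertices are on fire. The burning number $b(G)$ is the minimum number of rounds needed. A graph on $n$ vertices is well-burnable if $b(G)\le\lceil\sqrt n\,\rceil$. *)

(* Defs.v *)
From HB Require Import structures.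
From mathcomp Require Import all_boot all_order all_algebra.
From mathcomp Require Import reals.

Set Implicit Arguments.
Unset Strict Implicit.
Unset Printing Implicit Defensive.

Import Order.TTheory GRing.Theory Num.Theory.

Section Graphs.
Variables (T : finType) (e : rel T).

Definition simple_graph : Prop := symmetric e /\ irreflexive e.

(* In a simple graph a uniq e-cycle of size at least 3 is a cycle in the usual
   sense; those of size 2 are edges traversed back and forth. *)
Definition acyclic : Prop := forall c : seq T, ucycle e c -> size c <= 2.

Definition tree : Prop :=
  [/\ simple_graph, 0 < #|T|, (forall x y, connect e x y) & acyclic].

Definition degree (x : T) : nat := #|[set y | e x y]|.

Definition n_deg (k : nat) : nat := #|[set x | degree x == k]|.

Definition n_deg_ge (k : nat) : nat := #|[set x | k <= degree x]|.

Definition leaf (x : T) : bool := degree x == 1.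

Definition n_nonleaf : nat := #|[set x | ~~ leaf x]|.

Definition spread (B : {set T}) : {set T} :=
  B :|: [set y | [exists x in B, e x y]].

(* B is the set of vertices on fire at the end of the previous round. The fire
   spreads first, then x is set on fire. *)
Definition burn_step (B : {set T}) (x : T) : {set T} := x |: spread B.

(* The chosen vertex must be new, i.e. not yet on fire after the spread; the
   choice is immaterial when the spread has already reached every vertex. *)
Definition new_source (B : {set T}) (x : T) : bool :=
  (x \notin spread B) || (spread B == setT).

Fixpoint legal_sources (B : {set T}) (s : seq T) : bool :=
  if s is x :: s' then new_source B x && legal_sources (burn_step B x) s'
  else true.

Definition burned (s : seq T) : {set T} := foldl burn_step set0 s.

Definition burnable_in (m : nat) : bool :=
  [exists s : m.-tuple T, legal_sources set0 s && (burned s == setT)].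

Lemma ex_burning_choices (k : nat) (B : {set T}) :
  k <= #|T| -> #|T| <= #|B| + k ->
  exists s : k.-tuple T, legal_sources B s && (foldl burn_step B s == setT).
Proof.
elim: k B => [|k IHk] B lek leB.
  exists [tuple]; rewrite /= eqEcard subsetT cardsT.
  by rewrite addn0 in leB.
have [x Nx] : exists x, new_source B x && (#|T| <= #|burn_step B x| + k).
  have sBS : B \subset spread B by apply: subsetUl.
  have [/eqP fullS|/set0Pn[x]] := boolP (~: spread B == set0).
    have spT : spread B = setT by rewrite -[LHS]setCK fullS setC0.
    have [x _|T0] := pickP T.
      by exists x; rewrite /new_source /burn_step spT eqxx orbT setUT cardsT leq_addr.
    by move: lek; rewrite eq_card0.
  rewrite inE => xNS; exists x; rewrite /new_source xNS /=.
  rewrite /burn_step cardsU1 xNS add1n addSnnS.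
  by rewrite (leq_trans leB) // leq_add2r subset_leq_card.
case/andP: Nx => Nx /(IHk _ (ltnW lek))[s /andP[ls fs]].
by exists [tuple of x :: s]; rewrite /= Nx ls.
Qed.

Lemma ex_burnable_in : exists m, burnable_in m.
Proof.
exists #|T|; apply/existsP; apply: ex_burning_choices => //.
by rewrite cards0.
Qed.

Definition burning_number : nat := ex_minn ex_burnable_in.

End Graphs.

Local Open Scope ring_scope.

Definition concentration (R : realType) (T : finType) (e : rel T) (k : nat) : R :=
  (n_deg e k)%:R / (n_nonleaf e)%:R.

Definition concentration_ge (R : realType) (T : finType) (e : rel T) (k : nat) : R :=
  (n_deg_ge e k)%:R / (n_nonleaf e)%:R.

Definition well_burnable (R : realType) (T : finType) (e : rel T) : Prop :=
  (burning_number e)%:Z <= Num.ceil (Num.sqrt (#|T|%:R : R)).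

(* Main.v *)
Require Import Defs.
From mathcomp Require Import all_boot all_order all_algebra.
From mathcomp Require Import reals sequences exp.
From mathcomp Require Import zify ring lra.

(** The leaves of a tree can be burned in one extra round, and counting degrees
    shows that the hypothesis gives [n' < 3/4 n]. It thus suffices that a tree with
    [n'] vertices is covered by balls of radii [0, ..., m - 1] as soon as
    [n' <= 0.75 m^2] and [m] is large.

    Give each radius [r <= 10 D] a price [u r], nondecreasing in [r]. Take a
    longest path of a subtree of height [11 D], from its bottom. For each [j], the
    ball of radius [j/2] centred at height [j/2] covers the path up to height [j];
    what it misses in the side branches is covered by one ball per component. As [j]
    ranges over [1, ..., 20 D], a side branch pays on average for at most one ball of
    each radius per path of its longest-path decomposition, hence some [j] covers and
    removes a piece whose weight is at least [0.78 * 10 D / (average price)] times its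
    total price. Iterating, with prices exponential in the number of times that each
    range of radii was used, uses all ranges of radii almost equally often. *)

Set Implicit Arguments.
Unset Strict Implicit.
Unset Printing Implicit Defensive.

Import Order.TTheory GRing.Theory Num.Theory.

(** * Balls and burning sequences *)

Section Balls.
Variables (V : finType) (e : rel V).

Definition ball (v : V) (k : nat) : {set V} := iter k (spread e) [set v].

Lemma sub_spread (B : {set V}) : B \subset spread e B.
Proof. exact: subsetUl. Qed.

Lemma spreadS (B C : {set V}) : B \subset C -> spread e B \subset spread e C.
Proof.
move=> sBC; apply/subsetP => y; rewrite !inE => /orP[/(subsetP sBC)->//|].
case/existsP=> x /andP[xB exy]; apply/orP; right.
by apply/existsP; exists x; rewrite (subsetP sBC).
Qed.

Lemma iter_spreadS k (B C : {set V}) :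
  B \subset C -> iter k (spread e) B \subset iter k (spread e) C.
Proof. by move=> sBC; elim: k => //= k IHk; apply: spreadS. Qed.

Lemma sub_iter_spread k (B : {set V}) : B \subset iter k (spread e) B.
Proof. by elim: k => //= k IHk; apply: subset_trans (sub_spread _). Qed.

Lemma ball_trans u v w a b :
  u \in ball v a -> w \in ball u b -> w \in ball v (a + b).
Proof.
move=> uv; rewrite /ball addnC iterD; apply/subsetP/iter_spreadS.
by rewrite sub1set.
Qed.

Lemma ball_id v k : v \in ball v k.
Proof. by rewrite (subsetP (sub_iter_spread _ _)) ?set11. Qed.

Lemma ball_le v a b x : a <= b -> x \in ball v a -> x \in ball v b.
Proof. by move=> /subnKC <- xv; apply: ball_trans xv (ball_id _ _). Qed.

Lemma in_spread (B : {set V}) x y : x \in B -> e x y -> y \in spread e B.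
Proof.
by move=> xB exy; rewrite !inE; apply/orP; right; apply/existsP; exists x; rewrite xB.
Qed.

Lemma ball_edge v x k : x \in ball v k -> forall y, e x y -> y \in ball v k.+1.
Proof. by move=> xv y; apply: in_spread. Qed.

Lemma ball1 v x : e v x -> x \in ball v 1.
Proof. by apply: ball_edge; apply: ball_id. Qed.

Lemma ballS_parent v k x :
  x \in ball v k.+1 -> x \in ball v k \/ exists2 y, y \in ball v k & e y x.
Proof.
rewrite [ball v k.+1]iterS !inE => /orP[|/existsP[y /andP[yv eyx]]]; first by left.
by right; exists y.
Qed.

Lemma iter_spread_sub_burned B s :
  iter (size s) (spread e) B \subset foldl (burn_step e) B s.
Proof.
elim: s B => //= x s IHs B; apply: subset_trans (IHs _).
by rewrite -iterS iterSr iter_spreadS // subsetUr.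
Qed.

Lemma ball_sub_burned B s1 x s2 :
  ball x (size s2) \subset foldl (burn_step e) B (s1 ++ x :: s2).
Proof.
rewrite foldl_cat /=; apply: subset_trans (iter_spread_sub_burned _ _).
by apply: iter_spreadS; rewrite sub1set !inE eqxx.
Qed.

(** A source that is no longer new is replaced by any vertex not yet on fire, if one is left. By
    monotonicity of [spread] the new run stays ahead of the old one. *)
Lemma legal_burning (B C : {set V}) s :
  B \subset C -> foldl (burn_step e) B s = setT ->
  exists s', [/\ size s' = size s, legal_sources e C s'
               & foldl (burn_step e) C s' = setT].
Proof.
elim: s B C => [|x s IHs] B C sBC /=.
  by move=> BT; exists [::]; split=> //=; apply/eqP; rewrite -subTset -BT.
move=> sT.
suff [y Ny sy] : exists2 y, new_source e C y & burn_step e B x \subset burn_step e C y.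
  have [s' [zs' ls' fs']] := IHs _ _ sy sT.
  by exists (y :: s'); rewrite /= zs' Ny ls'.
have sS := spreadS sBC.
have [xC|xC] := boolP (x \in spread e C); last first.
  by exists x; rewrite /new_source ?xC // setUS.
have sub y : burn_step e B x \subset burn_step e C y.
  by apply/subsetP => z /setU1P[->|/(subsetP sS) zC]; apply/setU1P; right.
have [CT|CT] := boolP (spread e C == setT).
  by exists x; rewrite // /new_source CT orbT.
have /set0Pn[y] : ~: spread e C != set0.
  by apply: contra CT => /eqP C0; rewrite -[spread _ _]setCK C0 setC0.
by rewrite inE => yC; exists y; rewrite // /new_source yC.
Qed.

(** The centre [c r] is lit when [r] rounds remain, so the sources are [c (m - 1)], ..., [c 0].
    Repeated centres are repaired by [legal_burning]. *)
Lemma burning_number_le (m : nat) (c : nat -> V) :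
  (forall x, exists2 r, r < m & x \in ball (c r) r) -> burning_number e <= m.
Proof.
move=> cov; rewrite /burning_number; case: ex_minnP => k _; apply.
pose s := rev (mkseq c m).
have sT : foldl (burn_step e) set0 s = setT.
  apply/eqP; rewrite -subTset; apply/subsetP => x _.
  have [r rm xr] := cov x.
  have -> : s = rev (mkseq (fun i => c (r.+1 + i)) (m - r.+1)) ++ c r :: rev (mkseq c r).
    rewrite /s -rev_rcons -rev_cat; congr rev.
    rewrite -{1}(subnKC rm) /mkseq iotaD map_cat -[r.+1]addn1 iotaD map_cat /= cats1 add0n.
    by rewrite add0n -{1}[r + 1]addn0 iotaDl -map_comp.
  by apply: (subsetP (ball_sub_burned _ _ _ _)); rewrite size_rev size_mkseq.
have [s' [zs ls fs]] := legal_burning (subxx set0) sT.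
have zs' : size s' == m by rewrite zs size_rev size_mkseq.
by apply/existsP; exists (Tuple zs'); rewrite /= ls; apply/eqP.
Qed.

End Balls.

Arguments ball : simpl never.

(** * Rooted trees *)

(* A tree rooted at a vertex that is not recorded: [Edge x t] hangs the tree [t]
   rooted at [x] by one edge, [Glue] identifies the roots of two trees. Keeping
   [Glue] binary bounds the growth of the weight from a subterm to a term. *)
Inductive rtree (V : Type) :=
  | Bare
  | Edge of V & rtree V
  | Glue of rtree V & rtree V.

Arguments Bare {V}.

Fixpoint height V (t : rtree V) : nat :=
  match t with
  | Bare => 0
  | Edge _ t1 => (height t1).+1
  | Glue t1 t2 => maxn (height t1) (height t2)
  end.

Fixpoint verts V (t : rtree V) : seq V :=
  match t with
  | Bare => [::]
  | Edge x t1 => x :: verts t1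
  | Glue t1 t2 => verts t1 ++ verts t2
  end.

Definition weight V (t : rtree V) : nat := size (verts t).

Section RootedTrees.
Variables (V : finType) (e : rel V).
Hypothesis e_sym : symmetric e.
Implicit Types (t : rtree V) (v : V).

Fixpoint rooted v t : bool :=
  match t with
  | Bare => true
  | Edge x t1 => e v x && rooted x t1
  | Glue t1 t2 => rooted v t1 && rooted v t2
  end.

Lemma weight_Edge x t : weight (Edge x t) = (weight t).+1.
Proof. by []. Qed.

Lemma weight_Glue t1 t2 : weight (Glue t1 t2) = weight t1 + weight t2.
Proof. exact: size_cat. Qed.

Lemma height_le_weight t : height t <= weight t.
Proof.
elim: t => //= t1 IH1 t2 IH2; rewrite weight_Glue geq_max.
by rewrite (leq_trans IH1) ?leq_addr //= (leq_trans IH2) ?leq_addl.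
Qed.

Lemma weight_height0 t : height t = 0 -> weight t = 0.
Proof.
elim: t => //= t1 IH1 t2 IH2 /eqP; rewrite weight_Glue -leqn0 geq_max !leqn0.
by case/andP=> /eqP/IH1-> /eqP/IH2->.
Qed.

Lemma rooted_ball v t x :
  rooted v t -> x \in v :: verts t -> x \in ball e v (height t).
Proof.
elim: t v => [|y t IH|t1 IH1 t2 IH2] v /=.
- by move=> _; rewrite !inE => /eqP->.
- case/andP=> evy /IH{}IH; rewrite inE => /predU1P[->|/IH xy]; first exact: ball_id.
  by rewrite -[_.+1]add1n; apply: ball_trans xy; apply: ball1.
- case/andP=> /IH1{}IH1 /IH2{}IH2.
  rewrite inE mem_cat => /predU1P[->|/orP[] xt]; first exact: ball_id.
    by apply: ball_le (leq_maxl _ _) _; apply: IH1; rewrite inE xt orbT.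
  by apply: ball_le (leq_maxr _ _) _; apply: IH2; rewrite inE xt orbT.
Qed.

Section Strategies.
(* Balls of nominal radius [r] have actual radius [r + q]; a component of height
   at most [q] left over next to a ball is thus covered for free. *)
Variable q : nat.

Definition covered (L : seq (V * nat)) x : bool :=
  has (fun p => x \in ball e p.1 (p.2 + q)) L.

Lemma covered_cat L1 L2 x : covered (L1 ++ L2) x = covered L1 x || covered L2 x.
Proof. exact: has_cat. Qed.

Definition root_ball v t : seq (V * nat) :=
  if height t <= q then [::] else [:: (v, height t)].

(* One ball for each component of the part of [t] at distance more than [b]
   from the root. *)
Fixpoint leftover v t b : seq (V * nat) :=
  match t with
  | Bare => [::]
  | Edge x t1 => if b is b'.+1 then leftover x t1 b' else root_ball v t
  | Glue t1 t2 =>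
      if b is _.+1 then leftover v t1 b ++ leftover v t2 b else root_ball v t
  end.

Lemma leftover0 v t : leftover v t 0 = root_ball v t.
Proof. by case: t. Qed.

Lemma root_ball_cover v t c k x :
  rooted v t -> v \in ball e c k -> x \in verts t ->
  (x \in ball e c (k + q)) || covered (root_ball v t) x.
Proof.
move=> vt vc xt; have xv : x \in ball e v (height t).
  by apply: rooted_ball; rewrite // inE xt orbT.
rewrite /root_ball; case: leqP => hq /=.
  by rewrite (ball_trans vc (ball_le hq xv)).
by rewrite (ball_le _ xv) ?orbT // leq_addr.
Qed.

Lemma leftover_cover v t b c k x :
  rooted v t -> v \in ball e c k -> x \in verts t ->
  (x \in ball e c (k + b + q)) || covered (leftover v t b) x.
Proof.
elim: t v b k => [|y t IH|t1 IH1 t2 IH2] v [|b] k //; rewrite ?addn0;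
  try exact: root_ball_cover.
- move=> /= /andP[evy ty] vc; rewrite inE => /predU1P[->|xt].
    by rewrite (ball_le _ (ball_edge vc evy)) //; lia.
  rewrite -addSnnS; apply: IH xt => //; exact: ball_edge vc _ evy.
- move=> /= /andP[vt1 vt2] vc; rewrite mem_cat covered_cat => /orP[] xt.
    by case/orP: (IH1 _ b.+1 _ vt1 vc xt) => ->; rewrite ?orbT.
  by case/orP: (IH2 _ b.+1 _ vt2 vc xt) => ->; rewrite ?orbT.
Qed.

(** A ball is spent only on a height above [q], hence on more than [q] vertices. Summed over
    disjoint components, this bounds the number of balls used in one step. *)
Lemma root_ball_size v t : size (root_ball v t) * q <= weight t.
Proof.
rewrite /root_ball; have := height_le_weight t.
by case: (leqP (height t) q) => /= hq; lia.
Qed.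

Lemma leftover_size v t b : size (leftover v t b) * q <= weight t.
Proof.
elim: t v b => [|y t IH|t1 IH1 t2 IH2] v [|b] //; try exact: root_ball_size.
  by rewrite (leq_trans (IH _ _)) // weight_Edge.
by rewrite /= size_cat mulnDl weight_Glue leq_add.
Qed.

Lemma leftover_radius v t b (p : V * nat) :
  p \in leftover v t b -> 0 < p.2 /\ p.2 + b <= height t.
Proof.
have top t' v' : p \in root_ball v' t' -> 0 < p.2 /\ p.2 + 0 <= height t'.
  rewrite /root_ball; case: (leqP (height t') q) => // hq; rewrite inE => /eqP-> /=.
  by rewrite addn0; split=> //; apply: leq_ltn_trans hq.
elim: t v b => [|y t IH|t1 IH1 t2 IH2] v [|b] //; try exact: top.
  by move/IH => /= [-> ?]; rewrite addnS ltnS.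
by rewrite /= mem_cat => /orP[/IH1|/IH2] [-> /leq_trans H]; split=> //;
   apply: H; rewrite ?leq_maxl ?leq_maxr.
Qed.

(* Follow a longest path down from the root. A ball reaching exactly from its
   bottom to height [j] reaches depth [j - i] in a branch at height [i]. *)
Fixpoint side v t j : seq (V * nat) :=
  match t with
  | Bare => [::]
  | Edge x t1 => side x t1 j
  | Glue t1 t2 =>
      if height t2 <= height t1 then side v t1 j ++ leftover v t2 (j - height t1)
      else side v t2 j ++ leftover v t1 (j - height t2)
  end.

(** The vertex at height [k] on the path followed by [side], or the root of a lower tree. *)
Fixpoint center v t k : V :=
  if height t <= k then v else
  match t with
  | Bare => v
  | Edge x t1 => center x t1 k
  | Glue t1 t2 => if height t2 <= height t1 then center v t1 k else center v t2 k
  end.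

Lemma center_near v t k : rooted v t -> v \in ball e (center v t k) (height t - k).
Proof.
elim: t v => [|y t IH|t1 IH1 t2 IH2] v /=; first by rewrite ball_id.
  case/andP=> evy /IH{}IH; case: ifP => hk; first by rewrite ball_id.
  have {}hk : k <= height t by lia.
  by rewrite subSn //; apply: ball_edge IH _ _; rewrite e_sym.
case/andP=> /IH1{}IH1 /IH2{}IH2; case: ifP => [|_]; first by rewrite ball_id.
by case: leqP.
Qed.

(** From height [j./2], the radius [uphalf j = j - j./2] reaches both the bottom of the path and
    height [j]. A branch at height [i > j./2] is entered with [j - i] steps left; everything hanging
    below the centre is no higher than [j./2], hence covered. *)
Lemma side_cover v t j x :
  rooted v t -> height t <= j -> x \in v :: verts t ->
  (x \in ball e (center v t j./2) (uphalf j + q)) || covered (side v t j) x.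
Proof.
move=> vt tj xt; have uh : uphalf j = j - j./2 by lia.
have rootP v' t' : rooted v' t' -> height t' <= j ->
    v' \in ball e (center v' t' j./2) (uphalf j + q).
  move=> vt' tj'; apply: ball_le (center_near _ vt'); lia.
have low v' t' : rooted v' t' -> height t' <= j./2 -> x \in v' :: verts t' ->
    (x \in ball e v' (uphalf j + q)).
  move=> vt' tj' /(rooted_ball vt'); apply: ball_le; lia.
elim: t v vt tj xt => [|y t IH|t1 IH1 t2 IH2] v vt tj xt.
- by rewrite (low v Bare).
- have [hj|hj] := leqP (height (Edge y t)) j./2.
    by rewrite /= ifT // (low _ _ vt hj xt).
  move: xt; rewrite inE => /predU1P[->|xt]; first by rewrite rootP.
  move: vt tj hj => /= /andP[_ vt] tj hj; rewrite leqNgt hj /=.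
  by apply: IH => //; apply: ltnW.
- have [hj|hj] := leqP (height (Glue t1 t2)) j./2.
    by rewrite /= ifT // (low _ _ vt hj xt).
  move: xt; rewrite inE => /predU1P[->|xt]; first by rewrite rootP.
  move: vt tj hj xt => /= /andP[vt1 vt2]; rewrite geq_max => /andP[tj1 tj2] hj.
  rewrite leqNgt hj /= mem_cat.
  case: leqP => h12; rewrite covered_cat => /orP[] xt.
  + by have /orP[->|->] := IH1 _ vt1 tj1 (mem_behead (s := v :: _) xt); rewrite ?orbT.
  + have := leftover_cover (j - height t1) vt2 (center_near j./2 vt1) xt.
    by case/orP=> [xc|->]; rewrite ?orbT // (ball_le _ xc) //; lia.
  + have := leftover_cover (j - height t2) vt1 (center_near j./2 vt2) xt.
    by case/orP=> [xc|->]; rewrite ?orbT // (ball_le _ xc) //; lia.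
  + by have /orP[->|->] := IH2 _ vt2 tj2 (mem_behead (s := v :: _) xt); rewrite ?orbT.
Qed.

Lemma side_size v t j : size (side v t j) * q <= weight t.
Proof.
elim: t v => [|y t IH|t1 IH1 t2 IH2] v //.
  by rewrite (leq_trans (IH _)) // weight_Edge.
rewrite /= weight_Glue; case: ifP => _; rewrite size_cat mulnDl.
  by rewrite leq_add // leftover_size.
by rewrite addnC leq_add // leftover_size.
Qed.

(** In the second case the ball reaches at least [12 D - 11 D = D] into each branch, so at most
    [10 D] of its height is left over. *)
Lemma side_radius D v t j (p : V * nat) :
  (height t <= 10 * D) || ((height t <= 11 * D) && (12 * D <= j)) ->
  p \in side v t j -> 0 < p.2 <= 10 * D.
Proof.
elim: t v => [|y t IH|t1 IH1 t2 IH2] v //.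
  by move=> /= hD; apply: IH; lia.
move=> /= hD; case: ifP => h12; rewrite mem_cat => /orP[].
- by apply: IH1; lia.
- by case/leftover_radius; lia.
- by apply: IH2; lia.
- by case/leftover_radius; lia.
Qed.

(** The first subterm of height at most [c] on the path followed by [side]; [prune] keeps the rest.
    The root of the cut subterm stays in the rest, so the recorded vertices are split exactly. *)
Fixpoint cut v t c : V * rtree V :=
  if height t <= c then (v, t) else
  match t with
  | Bare => (v, t)
  | Edge x t1 => cut x t1 c
  | Glue t1 t2 => if height t2 <= height t1 then cut v t1 c else cut v t2 c
  end.

Fixpoint prune t c : rtree V :=
  if height t <= c then Bare else
  match t with
  | Bare => Bare
  | Edge x t1 => Edge x (prune t1 c)
  | Glue t1 t2 =>
      if height t2 <= height t1 then Glue (prune t1 c) t2 else Glue t1 (prune t2 c)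
  end.

Lemma cut_id v t c : height t <= c -> cut v t c = (v, t).
Proof. by case: t => [|x t|t1 t2] //= ->. Qed.

Lemma cut_height v t c : height (cut v t c).2 = minn c (height t).
Proof.
elim: t v => [|x t IH|t1 IH1 t2 IH2] v /=; first by rewrite minn0.
  by case: ifP => //= hc; rewrite ?IH; lia.
by case: ifP => [/= hc|hc]; [lia | case: ifP => h12; rewrite ?IH1 ?IH2; lia].
Qed.

Lemma cut_rooted v t c : rooted v t -> rooted (cut v t c).1 (cut v t c).2.
Proof.
elim: t v => [|x t IH|t1 IH1 t2 IH2] v //= /andP[].
  by case: ifP => [_ /= -> ->|_ _ /IH].
by case: ifP => _; [move=> /= -> -> | case: ifP => _ /IH1 r1 /IH2 r2].
Qed.

Lemma prune_rooted v t c : rooted v t -> rooted v (prune t c).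
Proof.
elim: t v => [|x t IH|t1 IH1 t2 IH2] v //= /andP[].
  by case: ifP => //= _ -> /IH.
by case: ifP => //= _; case: ifP => /= _ r1 r2; rewrite ?IH1 ?IH2 ?r1 ?r2.
Qed.

Lemma cut_prune_perm v t c :
  perm_eq (verts t) (verts (cut v t c).2 ++ verts (prune t c)).
Proof.
elim: t v => [|x t IH|t1 IH1 t2 IH2] v //=; case: ifP => _ /=; rewrite ?cats0 //.
  by rewrite perm_sym perm_catC /= perm_cons perm_catC perm_sym.
case: ifP => _ /=; first by rewrite catA perm_cat2r.
by rewrite perm_sym perm_catCA perm_cat2l perm_sym.
Qed.

Lemma cut_prune_weight v t c : weight t = weight (cut v t c).2 + weight (prune t c).
Proof. by rewrite /weight (perm_size (cut_prune_perm v t c)) size_cat. Qed.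

End Strategies.
End RootedTrees.

(** * Averaging over the reach of a ball *)

Section Averaging.
Local Open Scope ring_scope.
Variables (V : finType) (e : rel V).
Hypothesis e_sym : symmetric e.
Variables (F : realFieldType) (u : nat -> F) (om : F) (q : nat).
Hypothesis u_ge0 : forall y, 0 <= u y.
Hypothesis u_prefix : forall l : nat, \sum_(y < l) u y.+1 <= om * l%:R.

Definition cost (L : seq (V * nat)) : F := \sum_(p <- L) u p.2.

Lemma om_ge0 : 0 <= om.
Proof. by have := u_prefix 1; rewrite big_ord1 mulr1; apply: le_trans. Qed.

Lemma cost_ge0 L : 0 <= cost L.
Proof. exact: sumr_ge0. Qed.

Lemma cost_cat L1 L2 : cost (L1 ++ L2) = cost L1 + cost L2.
Proof. exact: big_cat. Qed.

Lemma cost_root_ball v t : cost (root_ball q v t) <= u (height t).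
Proof.
by rewrite /root_ball; case: ifP => _; rewrite /cost ?big_nil // big_seq1.
Qed.

(** The ball needed for the higher of the two trees serves both. *)
Lemma cost_root_ball_Glue v (t1 t2 : rtree V) :
  cost (root_ball q v (Glue t1 t2)) <= cost (root_ball q v t1) + cost (root_ball q v t2).
Proof.
have c1 := cost_ge0 (root_ball q v t1); have c2 := cost_ge0 (root_ball q v t2).
have [h12|h12] := leqP (height t1) (height t2).
  suff -> : root_ball q v (Glue t1 t2) = root_ball q v t2 by rewrite lerDr.
  by rewrite /root_ball /= (maxn_idPr h12).
suff -> : root_ball q v (Glue t1 t2) = root_ball q v t1 by rewrite lerDl.
by rewrite /root_ball /= (maxn_idPl (ltnW h12)).
Qed.

(* Decomposing a tree into longest paths, each path of length [l] contributes at
   most one ball of each radius [1, ..., l] as [b] varies. *)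
Lemma leftover_sum v (t : rtree V) N :
  \sum_(b < N) cost (leftover q v t b)
    <= \sum_(y < height t) u y.+1 + om * ((weight t)%:R - (height t)%:R).
Proof.
have o0 := om_ge0.
have wh (t' : rtree V) : 0 <= (weight t')%:R - (height t')%:R :> F.
  by rewrite subr_ge0 ler_nat height_le_weight.
have rhs0 (t' : rtree V) :
    0 <= \sum_(y < height t') u y.+1 + om * ((weight t')%:R - (height t')%:R).
  by rewrite addr_ge0 ?sumr_ge0 // mulr_ge0.
elim: t v N => [|x t IH|t1 IH1 t2 IH2] v [|N]; rewrite ?[in X in X <= _]big_ord0 //.
- by rewrite big1 // => i _; rewrite /cost /= big_nil.
(* The term [b = 0] has the full height as radius and pays for the new last summand of the prices;
   the terms [b > 0] are those of [t]. *)
- rewrite big_ord_recl /= [in leRHS]big_ord_recr /=.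
  have := IH x N; have := cost_root_ball v (Edge x t) => /=.
  rewrite weight_Edge -[in X in _ -> _ -> _ <= X]natr1 -[in X in _ -> _ -> _ <= X]natr1.
  lra.
- have Hx (t' : rtree V) : \sum_(b < N.+1) cost (leftover q v t' b) =
    cost (root_ball q v t') + \sum_(b < N) cost (leftover q v t' b.+1).
    by rewrite big_ord_recl leftover0.
  have := IH1 v N.+1; have := IH2 v N.+1; rewrite !Hx.
  under [X in _ -> _ -> _ + X <= _]eq_bigr => b _ do rewrite /= cost_cat.
  rewrite big_split /= weight_Glue natrD.
  have := cost_root_ball_Glue v t1 t2.
  (* The higher tree keeps its sum of prices; the longest path of the lower one is charged at rate
     [om] instead. *)
  have := u_prefix (height t1); have := u_prefix (height t2).
  have [h12|h12] := leqP (height t1) (height t2); lra.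
Qed.

Lemma leftover_sum_weight v (t : rtree V) N :
  \sum_(b < N) cost (leftover q v t b) <= om * (weight t)%:R.
Proof.
apply: le_trans (leftover_sum v t N) _; have := u_prefix (height t); lra.
Qed.

Lemma shifted_sum (X : nat -> F) N H :
  \sum_(j < N | (H <= j)%N) X (j - H)%N = \sum_(b < N - H) X b.
Proof.
elim: N => [|N IH]; first by rewrite sub0n !big_ord0.
rewrite big_mkcond big_ord_recr -big_mkcond /= IH.
case: leqP => HN; first by rewrite subSn // big_ord_recr.
by rewrite addr0; have -> : (N.+1 - H = N - H)%N by lia.
Qed.

(** The longest path itself costs nothing here. A branch at height [i] is paid for only when
    [i <= c j <= j], and then with reach [j - i]; each reach occurs at most once, so
    [leftover_sum_weight] applies to the branch. *)
Lemma side_sum (c : nat -> nat) v (t : rtree V) N :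
  (forall j, c j <= j)%N ->
  \sum_(j < N) cost (side q (cut v t (c j)).1 (cut v t (c j)).2 j)
    <= om * ((weight t)%:R - (height t)%:R).
Proof.
move=> cj.
have glue v' (t1 t2 : rtree V) :
  \sum_(j < N) cost (side q (cut v' t1 (c j)).1 (cut v' t1 (c j)).2 j)
      <= om * ((weight t1)%:R - (height t1)%:R) ->
  \sum_(j < N) (cost (side q (cut v' t1 (c j)).1 (cut v' t1 (c j)).2 j) +
     (if (height t1 <= c j)%N then cost (leftover q v' t2 (j - height t1)) else 0))
    <= om * ((weight t1)%:R + (weight t2)%:R - (height t1)%:R).
  move=> IH; rewrite big_split /=.
  have : \sum_(j < N) (if (height t1 <= c j)%N
            then cost (leftover q v' t2 (j - height t1)) else 0) <= om * (weight t2)%:R.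
    apply: le_trans (leftover_sum_weight v' t2 (N - height t1)).
    rewrite -(shifted_sum (fun b => cost (leftover q v' t2 b))).
    rewrite big_mkcond /= [leRHS]big_mkcond /=.
    apply: ler_sum => j _; case: ifP => [hc|_]; last by case: ifP => //; rewrite cost_ge0.
    by rewrite ifT // (leq_trans hc).
  move: IH; lra.
elim: t v => [|x t IH|t1 IH1 t2 IH2] v.
- rewrite subrr mulr0 big1 // => j _; rewrite /= /cost /= big_nil //.
- apply: le_trans (_ : om * ((weight t)%:R - (height t)%:R) <= _); last first.
    by rewrite weight_Edge /= -!natr1; lra.
  apply: le_trans (IH x); apply: ler_sum => j _ /=.
  by case: leqP => //= hc; rewrite (cut_id x (ltnW hc)).
- rewrite weight_Glue natrD /=.
  have [h21|h12] := leqP (height t2) (height t1).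
    apply: le_trans (glue v t1 t2 (IH1 v)); apply: ler_sum => j _.
    case: (leqP (height t1) (c j)) => hc; last by rewrite addr0.
    by rewrite /= h21 cost_cat (cut_id _ hc).
  rewrite [X in om * (X - _)]addrC.
  apply: le_trans (glue v t2 t1 (IH2 v)); apply: ler_sum => j _.
  case: (leqP (height t2) (c j)) => hc; last by rewrite addr0.
  by rewrite /= leqNgt h12 cost_cat (cut_id _ hc).
Qed.

Lemma uphalf_sum n : \sum_(i < n.*2) u (uphalf i.+1) = 2 * \sum_(r < n) u r.+1.
Proof.
elim: n => [|n IH]; first by rewrite !big_ord0 mulr0.
rewrite doubleS !big_ord_recr /= IH mulrDr.
have -> : uphalf n.*2 = n by lia.
have -> : n.*2./2 = n by lia.
ring.
Qed.

Variable D : nat.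
Hypothesis D_gt0 : (0 < D)%N.

(* Branches above height [10 D] are included only when the ball reaches [D] further,
   so that no leftover component has height above [10 D]. *)
Definition cut_height_at (j : nat) : nat :=
  if (j <= 10 * D)%N then j else if (j < 12 * D)%N then (10 * D)%N else (11 * D)%N.

Lemma cut_height_atP j :
  [\/ (j <= 10 * D)%N /\ cut_height_at j = j,
      (10 * D < j < 12 * D)%N /\ cut_height_at j = (10 * D)%N |
      (12 * D <= j)%N /\ cut_height_at j = (11 * D)%N].
Proof.
rewrite /cut_height_at; case: ifP => j10; first by constructor 1.
by case: ifP => j12; [constructor 2 | constructor 3]; split=> //; lia.
Qed.

Lemma cut_height_at_le j : (cut_height_at j <= j)%N.
Proof. by case: (cut_height_atP j); lia. Qed.

(** For [height t = 11 D], the gains are at least [j] for [j <= 10 D], then [10 D] for [2 D] values,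
    then the whole weight for [8 D] values: in total [158 D^2 + 8 D s] with [s = weight t - 11 D],
    against the required [156 D^2 + 7.8 D s]. For weight at least [800 D] the last [8 D] values
    suffice. *)
Lemma gain_sum v (t : rtree V) :
  (height t <= 11 * D)%N ->
  (height t = 11 * D \/ 800 * D <= weight t)%N ->
  (2 * D * (20 * D + (weight t - height t)) * 39
     <= 10 * \sum_(i < 20 * D) weight (cut v t (cut_height_at i.+1)).2)%N.
Proof.
move=> tD big; set g := fun i => weight (cut v t (cut_height_at i.+1)).2.
have wh := height_le_weight t.
have g_ge i : (minn (cut_height_at i.+1) (height t) <= g i)%N.
  by rewrite -(cut_height v); apply: height_le_weight.
have split3 a b c : (\sum_(i < a + (b + c)) g i =
    \sum_(i < a) g i + (\sum_(i < b) g (a + i) + \sum_(i < c) g (a + (b + i))))%N.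
  by rewrite big_split_ord /= big_split_ord.
have -> : (\sum_(i < 20 * D) weight (cut v t (cut_height_at i.+1)).2 =
    \sum_(i < 10 * D + (2 * D + 8 * D)) g i)%N.
  by have -> : (10 * D + (2 * D + 8 * D) = 20 * D)%N by lia.
rewrite split3.
have s3 : (8 * D * weight t <= \sum_(i < 8 * D) g (10 * D + (2 * D + i)))%N.
  rewrite -{1}[(8 * D)%N]card_ord -sum_nat_const leq_sum // => i _.
  rewrite /g cut_id ?leqnn //.
  by case: (cut_height_atP (10 * D + (2 * D + i)).+1) => -[? ->]; lia.
case: big => [h11|w800]; last first.
  have dw := leq_mul (leqnn D) w800.
  have dh : (D * (weight t - height t) <= D * weight t)%N by rewrite leq_mul // leq_subr.
  move: s3 dw dh; set A := (\sum_(i < 8 * D) _)%N; clear.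
  by move: (weight t) (weight t - height t)%N => w h; lia.
have s2 : (2 * D * (10 * D) <= \sum_(i < 2 * D) g (10 * D + i))%N.
  rewrite -{1}[(2 * D)%N]card_ord -sum_nat_const leq_sum // => i _.
  by apply: leq_trans (g_ge _); case: (cut_height_atP (10 * D + i).+1); lia.
have s1 : (\sum_(i < 10 * D) i.+1 <= \sum_(i < 10 * D) g i)%N.
  apply: leq_sum => i _; apply: leq_trans (g_ge _).
  by have := ltn_ord i; case: (cut_height_atP i.+1); lia.
have s0 n : (n * n <= 2 * \sum_(i < n) i.+1)%N.
  elim: n => [|n]; rewrite ?big_ord0 // big_ord_recr [nat_of_ord ord_max]/=.
  by move: (\sum_(i < n) _)%N => S; rewrite -[_ S n.+1]/(S + n.+1)%N; lia.
have := s0 (10 * D)%N; move: wh s1 s2 s3; rewrite h11.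
set A := (\sum_(i < 8 * D) _)%N; set B := (\sum_(i < 2 * D) _)%N.
set C := (\sum_(i < 10 * D) g _)%N; set Z := (\sum_(i < 10 * D) _.+1)%N.
move=> wh s1 s2 s3 sZ.
have dw := leq_mul (leqnn D) wh.
have ds := mulnBr D (weight t) (11 * D).
by move: s1 s2 s3 sZ dw ds; clear; move: (weight t) => w; nia.
Qed.

Lemma efficient_cover v t :
  rooted e v t -> (height t <= 11 * D)%N ->
  (height t = 11 * D \/ 800 * D <= weight t)%N ->
  exists t' L, [/\ rooted e v t', (weight t' < weight t)%N,
    (forall p, p \in L -> (0 < p.2 <= 10 * D)%N) &
    [/\ forall x, x \in verts t -> (x \in verts t') || covered e q L x,
        (size L * q <= weight t + q)%N &
        78 * D%:R * cost L <= 10 * om * ((weight t)%:R - (weight t')%:R)]].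
Proof.
move=> vt tD big.
pose c := cut_height_at; pose s j := cut v t (c j).
pose L j := (center (s j).1 (s j).2 j./2, uphalf j) :: side q (s j).1 (s j).2 j.
(* If every [j] were inefficient, summing over [j] would contradict [gain_sum]: the total cost is at
   most [om * (20 D + weight t - height t)]. *)
suff [j /andP[j0 jD] eff] : exists2 j, (0 < j <= 20 * D)%N &
    78 * D%:R * cost (L j) <= 10 * om * (weight (s j).2)%:R.
  exists (prune t (c j)), (L j).
  have wt := cut_prune_weight v t (c j); have hs := cut_height v t (c j).
  have hw := height_le_weight (cut v t (c j)).2.
  have ht : (0 < height t)%N.
    by have := @weight_height0 _ t; case: big; lia.
  split; first exact: prune_rooted.
  - by move: hw; rewrite hs wt /c; case: (cut_height_atP j); lia.
  - move=> p; rewrite inE => /predU1P[->|] /=; first lia.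
    by apply: side_radius; rewrite hs /c; case: (cut_height_atP j); lia.
  - split.
    + move=> x; rewrite (perm_mem (cut_prune_perm v t (c j))) mem_cat.
      case/orP=> xt; last by rewrite xt.
      apply/orP; right; rewrite /=.
      apply: side_cover => //; first exact: cut_rooted.
        by rewrite hs (leq_trans (geq_minl _ _)) // cut_height_at_le.
      by rewrite inE xt orbT.
    + rewrite /= mulSn addnC leq_add2r (leq_trans (side_size _ _ _ _)) //.
      by rewrite wt leq_addr.
    + by rewrite wt natrD addrK.
have [/existsP[i eff]|none] := boolP [exists i : 'I_(20 * D),
    78 * D%:R * cost (L i.+1) <= 10 * om * (weight (s i.+1).2)%:R].
  by exists i.+1 => //; rewrite ltn_ord.
have: \sum_(i < 20 * D) 10 * om * (weight (s i.+1).2)%:R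
      < \sum_(i < 20 * D) 78 * D%:R * cost (L i.+1).
  apply: ltr_sum => [|i _].
    have D20 : (0 < 20 * D)%N by lia.
    by apply/hasP; exists (Ordinal D20); rewrite ?mem_index_enum.
  by move: none; rewrite negb_exists => /forallP/(_ i); rewrite -ltNge.
rewrite -!mulr_sumr -natr_sum ltNge => /negP[].
have -> : \sum_(i < 20 * D) cost (L i.+1) = \sum_(i < 20 * D) u (uphalf i.+1) +
    \sum_(i < 20 * D) cost (side q (s i.+1).1 (s i.+1).2 i.+1).
  by rewrite -big_split; apply: eq_bigr => i _; rewrite /cost big_cons.
have -> : \sum_(i < 20 * D) u (uphalf i.+1) = 2 * \sum_(r < 10 * D) u r.+1.
  by rewrite -uphalf_sum; have -> : ((10 * D).*2 = 20 * D)%N by lia.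
(* [side_sum] starts at [j = 0]; that nonnegative term is dropped. *)
have sides := side_sum v t (20 * D).+1 cut_height_at_le.
rewrite big_ord_recl in sides.
have {}sides := le_trans (ler_wpDl (cost_ge0 _) (lexx _)) sides.
have := u_prefix (10 * D).
have := gain_sum v tD big.
rewrite -(ler_nat F) !natrM natrD natrB ?height_le_weight // natrM.
have o0 := om_ge0.
move: sides; rewrite -/c -/s.
set S1 := \sum_(i < _) cost _; set S2 := \sum_(i < _) u _.
set G := (\sum_(i < _) _)%N%:R.
have D0 : 0 <= D%:R :> F by [].
nra.
Qed.
End Averaging.

(** * Multiplicative weights *)

Definition small V D (t : rtree V) : bool :=
  (height t < 11 * D) && (weight t < 800 * D).

Definition efficient_step (V : finType) (e : rel V) (F : realFieldType)
    (u : nat -> F) (om : F) (q D : nat) v t : Prop :=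
  exists t' L, [/\ rooted e v t', weight t' < weight t,
    (forall p : V * nat, p \in L -> 0 < p.2 <= 10 * D) &
    [/\ forall x, x \in verts t -> (x \in verts t') || covered e q L x,
        size L * q <= 1600 * D + q &
        (78 * D%:R * cost u L <= 10 * om * ((weight t)%:R - (weight t')%:R))%R]].

(** Descend to a subterm that is not small but whose immediate subterms are. Its height is at most
    [11 D] and its weight at most [1600 D], and failing to be small is just what [efficient_cover]
    asks for. *)
Lemma efficient_peel (V : finType) (e : rel V) (F : realFieldType) (u : nat -> F)
    (om : F) (q D : nat) v t :
  symmetric e -> (forall y, 0 <= u y)%R ->
  (forall l : nat, \sum_(y < l) u y.+1 <= om * l%:R)%R -> 0 < D ->
  rooted e v t -> ~~ small D t -> efficient_step e u om q D v t.
Proof.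
move=> e_sym u0 up D0.
have direct v' t0 : rooted e v' t0 -> height t0 <= 11 * D -> weight t0 <= 1600 * D ->
    ~~ small D t0 -> efficient_step e u om q D v' t0.
  move=> vt h w; rewrite /small => Nsmall.
  have big : height t0 = 11 * D \/ 800 * D <= weight t0 by lia.
  have [t' [L [r1 r2 r3 [r4 r5 r6]]]] := efficient_cover e_sym q u0 up D0 vt h big.
  by exists t', L; split=> //; split=> //; rewrite (leq_trans r5) // leq_add2r.
elim: t v => [|x t IH|t1 IH1 t2 IH2] v.
- by rewrite /small /weight /=; lia.
- move=> /= /andP[evx xt] Nsmall.
  have [st|Nst] := boolP (small D t); last first.
    have [t' [L [r1 r2 r3 [r4 r5 r6]]]] := IH _ xt Nst.
    exists (Edge x t'), L; split=> //; first by rewrite /= evx.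
    split=> //; first move=> y.
      by rewrite !inE => /predU1P[->|/r4]; rewrite ?eqxx // -orbA => ->; rewrite orbT.
    by rewrite !weight_Edge -!natr1; lra.
  apply: direct => //=; rewrite ?evx //; move: st; rewrite /small ?weight_Edge; lia.
- move=> /= /andP[vt1 vt2] Nsmall.
  have [st1|Nst1] := boolP (small D t1); last first.
    have [t' [L [r1 r2 r3 [r4 r5 r6]]]] := IH1 _ vt1 Nst1.
    exists (Glue t' t2), L; split=> //; first by rewrite /= r1.
      by rewrite !weight_Glue ltn_add2r.
    split=> //; last by rewrite !weight_Glue !natrD; lra.
    by move=> y; rewrite !mem_cat => /orP[/r4/orP[]|] ->; rewrite ?orbT.
  have [st2|Nst2] := boolP (small D t2); last first.
    have [t' [L [r1 r2 r3 [r4 r5 r6]]]] := IH2 _ vt2 Nst2.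
    exists (Glue t1 t'), L; split=> //; first by rewrite /= r1 vt1.
      by rewrite !weight_Glue ltn_add2l.
    split=> //; last by rewrite !weight_Glue !natrD; lra.
    by move=> y; rewrite !mem_cat => /orP[|/r4/orP[]] ->; rewrite ?orbT.
  apply: direct => //=; rewrite ?vt1 //; move: st1 st2; rewrite /small ?weight_Glue; lia.
Qed.

(** A ball of radius [10 D] at the root leaves only components of height less than [D]. *)
Lemma small_cover (V : finType) (e : rel V) q D v t :
  symmetric e -> 0 < D -> rooted e v t -> small D t ->
  exists L, [/\ forall p, p \in L -> 0 < p.2 <= 10 * D,
    forall x, x \in v :: verts t -> covered e q L x & size L * q <= 1600 * D + q].
Proof.
move=> e_sym D0 vt /andP[hD wD].
exists ((v, 10 * D) :: leftover q v t (10 * D)); split.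
- move=> p; rewrite inE => /predU1P[->|/leftover_radius] /=; first lia.
  by case=> -> /=; lia.
- move=> x; rewrite inE => /predU1P[->|xt] /=; first by rewrite ball_id.
  exact: (leftover_cover _ _ vt (ball_id _ _ 0) xt).
- have := leftover_size q v t (10 * D); rewrite /= mulSn; lia.
Qed.

Section MultiplicativeWeights.
Local Open Scope ring_scope.
Variables (R : realType) (V : finType) (e : rel V) (E q : nat).
Hypotheses (e_sym : symmetric e) (E_gt0 : (0 < E)%N) (q_gt0 : (0 < q)%N).
Let D := (E * q)%N.
Let B := (10 * E).+2.

(** * Prices of radii from weights of bins *)

Section Prices.
Variable w : nat -> R.
Hypothesis w_ge0 : forall b, 0 <= w b.

(** Bin [b] stands for the [q] radii from [b * q] on, so any of them serves a ball of actual radius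
    [r + q]. For [r <= 10 D] the last bin [10 E + 1] always qualifies. *)
Definition cheapest (r : nat) : nat :=
  [arg min_(b < (ord_max : 'I_B) | (r + q <= b * q)%N) w b]%O.

Lemma cheapest_lt r : (cheapest r < B)%N.
Proof. exact: ltn_ord. Qed.

Lemma cheapestP r : (r <= 10 * D)%N -> (r + q <= cheapest r * q)%N /\
  forall b, (b < B)%N -> (r + q <= b * q)%N -> w (cheapest r) <= w b.
Proof.
move=> rD; rewrite /cheapest; case: Order.TotalTheory.arg_minP => [|b rb bmin].
  by rewrite /= /B; move: rD; rewrite /D; nia.
by split=> // b' b'B rb'; apply: (bmin (Ordinal b'B)).
Qed.

(** The balls bought have radius at most [10 D]; the value 0 beyond lets the prefix bound hold for
    every length. *)
Definition price (r : nat) : R := if (r <= 10 * D)%N then w (cheapest r) else 0.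

Lemma price_ge0 r : 0 <= price r.
Proof. by rewrite /price; case: ifP. Qed.

Lemma price_mono r s : (r <= s <= 10 * D)%N -> price r <= price s.
Proof.
move=> /andP[rs sD]; rewrite /price sD (leq_trans rs sD).
have [_ +] := cheapestP (leq_trans rs sD); apply; first exact: cheapest_lt.
by have [+ _] := cheapestP sD; apply: leq_trans; rewrite leq_add2r.
Qed.

(** A radius in [(n q, (n + 1) q]] may use bin [n + 2], so each bin is charged for at most [q]
    radii. *)
Lemma price_total : \sum_(y < 10 * D) price y.+1 <= q%:R * \sum_(b < B) w b.
Proof.
have main n : (n <= 10 * E)%N ->
    \sum_(y < n * q) price y.+1 <= q%:R * \sum_(b < n) w b.+2.
  elim: n => [|n IHn] nE; first by rewrite mul0n !big_ord0 mulr0.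
  rewrite mulSn addnC big_split_ord /= big_ord_recr /= mulrDr lerD ?IHn ?(ltnW nE) //.
  rewrite mulr_natl -[q in leRHS]card_ord -sumr_const; apply: ler_sum => k _.
  have kq := ltn_ord k; have yD : ((n * q + k).+1 <= 10 * D)%N by rewrite /D; nia.
  rewrite /price yD; have [_ +] := cheapestP yD; apply; first by rewrite /B; lia.
  by lia.
rewrite /D mulnA; apply: le_trans (main _ (leqnn _)) _.
rewrite ler_wpM2l // /B !big_ord_recl /= addrA lerDr.
by rewrite addr_ge0.
Qed.

(** Prices are nondecreasing up to [10 D], so an average over a prefix is at most the overall
    average, which [price_total] bounds. *)
Lemma price_prefix l :
  \sum_(y < l) price y.+1 <= ((\sum_(b < B) w b) / (10 * E%:R)) * l%:R.
Proof.
set W := \sum_(b < B) w b.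
have W0 : 0 <= W by apply: sumr_ge0.
have om0 : 0 <= W / (10 * E%:R) by rewrite divr_ge0 // mulr_ge0.
have omD : W / (10 * E%:R) * (10 * D)%:R = q%:R * W.
  by rewrite /D !natrM; field; rewrite pnatr_eq0; lia.
have [lD|Dl] := leqP l (10 * D); last first.
  apply: le_trans (_ : q%:R * W <= _); last by rewrite -omD ler_wpM2l // ler_nat ltnW.
  apply: le_trans price_total; rewrite -(subnKC (ltnW Dl)) big_split_ord /= gerDl.
  apply: sumr_le0 => i _; rewrite /price ifF //; lia.
have tot := price_total; rewrite -(subnKC lD) big_split_ord /= -omD in tot.
set S1 := \sum_(i < l) _ in tot *; set S2 := \sum_(i < 10 * D - l) _ in tot.
have S1le : S1 <= l%:R * price l.
  rewrite mulr_natl -[X in _ *+ X]card_ord -sumr_const; apply: ler_sum => i _.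
  by apply: price_mono; rewrite ltn_ord.
have S2ge : (10 * D - l)%:R * price l <= S2.
  rewrite mulr_natl -[X in _ *+ X]card_ord -sumr_const; apply: ler_sum => i _.
  by apply: price_mono; have := ltn_ord i; lia.
rewrite natrB // in S2ge.
have D0 : 0 < (10 * D)%:R :> R by rewrite ltr0n /D; nia.
have lD' : l%:R <= (10 * D)%:R :> R by rewrite ler_nat.
have l0' : 0 <= l%:R :> R by [].
rewrite -(ler_pM2l D0).
have : ((10 * D)%:R - l%:R) * S1 <= l%:R * S2.
  have h1 : ((10 * D)%:R - l%:R) * S1 <= ((10 * D)%:R - l%:R) * (l%:R * price l).
    by rewrite ler_wpM2l // subr_ge0.
  have h2 : l%:R * (((10 * D)%:R - l%:R) * price l) <= l%:R * S2 by rewrite ler_wpM2l.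
  by apply: le_trans h1 _; apply: le_trans h2; rewrite mulrCA.
have : l%:R * (S1 + S2) <= l%:R * (W / (10 * E%:R) * (10 * D)%:R) by rewrite ler_wpM2l.
lra.
Qed.
End Prices.

(** * The exponential potential *)

Variable eta : R.
Hypothesis eta_gt0 : 0 < eta.
(* Bounds the number of balls used in one step. *)
Let kap := (1600 * E).+1.

Definition uses (L : seq (V * nat)) (b : nat) : nat := count (fun p => p.2 == b) L.

Definition fire_price (U : nat -> nat) (b : nat) : R := expR (eta * (U b)%:R).

Definition potential (U : nat -> nat) : R := \sum_(b < B) fire_price U b.

Lemma expR_le1Dx (x : R) : expR x <= 1 + x * expR x.
Proof.
have := expR_ge1Dx (- x); rewrite expRN -(ler_pM2r (expR_gt0 x)) mulVf ?gt_eqF ?expR_gt0 //.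
by rewrite mulrDl mul1r mulNr; lra.
Qed.

Lemma uses_sum (f : nat -> R) (L : seq (V * nat)) :
  (forall p, p \in L -> p.2 < B)%N ->
  \sum_(b < B) (uses L b)%:R * f b = \sum_(p <- L) f p.2.
Proof.
elim: L => [|p L IHL] LB.
  by rewrite big_nil big1 // => b _; rewrite mul0r.
have pB : (p.2 < B)%N by apply: LB; rewrite mem_head.
rewrite big_cons -IHL; last by move=> p' p'L; apply: LB; rewrite inE p'L orbT.
rewrite (bigD1 (Ordinal pB)) //= [in RHS](bigD1 (Ordinal pB)) //= eqxx natrD.
rewrite mulrDl mul1r -!addrA; congr (_ + (_ + _)); apply: eq_bigr => b bp.
by rewrite [p.2 == b]eq_sym -[(b : nat) == p.2]/(b == Ordinal pB) (negbTE bp).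
Qed.

(** A bin used [k <= kap] times has its price multiplied by [e^(eta k) <= 1 + eta k e^(eta kap)], so
    the increase is linear in the cost at the old prices. *)
Lemma potential_step U (L : seq (V * nat)) :
  (forall p, p \in L -> p.2 < B)%N -> (size L <= kap)%N ->
  potential (fun b => U b + uses L b)%N
    <= potential U + eta * expR (eta * kap%:R) * \sum_(p <- L) fire_price U p.2.
Proof.
move=> LB Lk; rewrite -(uses_sum _ LB) mulr_sumr -big_split /=; apply: ler_sum => b _.
rewrite /fire_price natrD mulrDr expRD; set w := expR (eta * (U b)%:R).
set k := uses L b; have w0 : 0 < w by apply: expR_gt0.
have kk : (k <= kap)%N by apply: leq_trans Lk; apply: count_size.
have ex : expR (eta * k%:R) <= 1 + eta * k%:R * expR (eta * kap%:R).
  apply: le_trans (expR_le1Dx _) _; rewrite lerD2l.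
  apply: ler_wpM2l; first by rewrite mulr_ge0 // ltW.
  by rewrite ler_expR ler_pM2l // ler_nat.
have := ler_wpM2l (ltW w0) ex; lra.
Qed.

Lemma fires_to_bins (w : nat -> R) (L : seq (V * nat)) :
  (forall p, p \in L -> (0 < p.2 <= 10 * D)%N) ->
  let L1 := [seq (p.1, cheapest w p.2) | p <- L] in
  [/\ forall p, p \in L1 -> (p.2 < B)%N, size L1 = size L,
     \sum_(p <- L1) w p.2 = cost (price w) L &
     forall x, covered e q L x -> has (fun p => x \in ball e p.1 (p.2 * q)) L1].
Proof.
move=> LD /=; split.
- by move=> p /mapP[p' _ ->]; apply: cheapest_lt.
- by rewrite size_map.
- rewrite big_map /cost !big_seq; apply: eq_bigr => p /LD/andP[_ pD].
  by rewrite /price pD.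
- move=> x /hasP[p pL xp]; rewrite has_map; apply/hasP; exists p => //=.
  have /andP[_ pD] := LD _ pL; have [h _] := cheapestP w pD.
  exact: ball_le xp.
Qed.

Lemma uses_cat L1 L2 b : uses (L1 ++ L2) b = (uses L1 b + uses L2 b)%N.
Proof. exact: count_cat. Qed.

(** A step removing weight [g] multiplies the potential by at most [exp (X g / lam)], with
    [X = eta e^(eta kap)] and [lam = 78 E^2 q]; these factors telescope. The final small tree adds
    at most [kap] uses to a bin. *)
Lemma balanced_cover (U : nat -> nat) v t :
  rooted e v t ->
  exists L : seq (V * nat), [/\ forall p, p \in L -> (p.2 < B)%N,
    forall x, x \in v :: verts t -> has (fun p => x \in ball e p.1 (p.2 * q)) L &
    forall b, (b < B)%N -> expR (eta * (U b + uses L b)%:R) <= potential U *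
      expR (eta * expR (eta * kap%:R) * (weight t)%:R / (78 * E%:R ^+ 2 * q%:R)
            + eta * kap%:R)].
Proof.
have D0 : (0 < D)%N by rewrite /D muln_gt0 E_gt0.
have E0 : 0 < E%:R :> R by rewrite ltr0n.
have q0 : 0 < q%:R :> R by rewrite ltr0n.
have sizeP (L : seq (V * nat)) : (size L * q <= 1600 * D + q)%N -> (size L <= kap)%N.
  by rewrite /D mulnA -mulSnr leq_pmul2r.
have [n] := ubnP (weight t); elim: n t U => // n IHn t U tn vt.
have [st|Nst] := boolP (small D t).
  have [L [LD Lc Ls]] := small_cover q e_sym D0 vt st.
  have [L1B L1s _ L1c] := fires_to_bins (fire_price U) LD.
  exists [seq (p.1, cheapest (fire_price U) p.2) | p <- L]; split=> //.
    by move=> x /Lc/L1c.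
  move=> b bB; rewrite natrD mulrDr expRD.
  apply: ler_pM; rewrite ?expR_ge0 //.
    rewrite /potential (bigD1 (Ordinal bB)) //= lerDl sumr_ge0 // => i _.
    exact: expR_ge0.
  rewrite ler_expR; apply: le_trans (_ : eta * kap%:R <= _).
    rewrite ler_pM2l // ler_nat; apply: leq_trans (sizeP _ Ls).
    by rewrite -L1s count_size.
  by rewrite lerDr divr_ge0 // !mulr_ge0 ?expR_ge0 // ltW.
have w0 b : 0 <= fire_price U b by apply: expR_ge0.
have [t' [L [vt' wt' LD [Lc Ls Lcost]]]] :=
  efficient_peel q e_sym (price_ge0 w0) (price_prefix w0) D0 vt Nst.
have [L1B L1s L1w L1c] := fires_to_bins (fire_price U) LD.
set L1 := [seq _ | p <- L] in L1B L1s L1w L1c.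
have [L2 [L2B L2c L2p]] := IHn t' (fun b => U b + uses L1 b)%N (leq_trans wt' tn) vt'.
exists (L1 ++ L2); split.
- by move=> p; rewrite mem_cat => /orP[/L1B|/L2B].
- move=> x; rewrite has_cat inE => /predU1P[->|/Lc/orP[xt|/L1c->//]].
    by rewrite L2c ?orbT ?mem_head.
  by rewrite L2c ?orbT // inE xt orbT.
- move=> b bB; rewrite uses_cat addnA; apply: le_trans (L2p b bB) _.
  have L1k : (size L1 <= kap)%N by rewrite L1s sizeP.
  have step := potential_step U L1B L1k; rewrite L1w in step.
  set lam := 78 * E%:R ^+ 2 * q%:R.
  have lam0 : 0 < lam by rewrite /lam !mulr_gt0 ?exprn_gt0.
  set g := (weight t)%:R - (weight t')%:R : R.
  have P0 : 0 <= potential U by apply: sumr_ge0.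
  (* The efficient step is read with [om = potential U / (10 E)] and [D = E q]. *)
  have costle : cost (price (fire_price U)) L <= potential U * (g / lam).
    rewrite mulrA ler_pdivlMr // /lam.
    move: Lcost; rewrite -/(potential U) -/g /D natrM; set c := cost _ L => Lcost.
    have -> : c * (78 * E%:R ^+ 2 * q%:R) = E%:R * (78 * (E%:R * q%:R) * c) by ring.
    apply: le_trans (ler_wpM2l (ltW E0) Lcost) _.
    rewrite le_eqVlt; apply/orP; left; apply/eqP; field.
    by rewrite gt_eqF.
  set X := eta * expR (eta * kap%:R).
  have X0 : 0 <= X by rewrite mulr_ge0 ?expR_ge0 // ltW.
  have stepX : potential (fun b => U b + uses L1 b)%N <= potential U * expR (X * (g / lam)).
    apply: le_trans step _; apply: le_trans (_ : potential U * (1 + X * (g / lam)) <= _).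
      by have := ler_wpM2l X0 costle; rewrite -/X; lra.
    by rewrite ler_wpM2l // expR_ge1Dx.
  have -> : X * (weight t)%:R / lam = X * (g / lam) + X * (weight t')%:R / lam.
    by rewrite /g; field; rewrite gt_eqF.
  rewrite -addrA [expR (X * (g / lam) + _)]expRD mulrA ler_pM2r ?expR_gt0 //.
Qed.
End MultiplicativeWeights.

(** * Covering large trees *)

Lemma bins_to_radii (V : finType) (e : rel V) (q B : nat) (v : V) (L : seq (V * nat)) :
  (forall p, p \in L -> p.2 < B) -> (forall b, b < B -> uses L b <= q) ->
  exists c : nat -> V, forall x, has (fun p => x \in ball e p.1 (p.2 * q)) L ->
    exists2 r, r < B * q & x \in ball e (c r) r.
Proof.
move=> LB Lq; pose l b := [seq p.1 | p <- L & p.2 == b].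
exists (fun r => nth v (l (r %/ q)) (r %% q)) => x /hasP[p pL xp].
have pl : p.1 \in l p.2 by apply: map_f; rewrite mem_filter eqxx.
have pB := LB _ pL.
have iq : index p.1 (l p.2) < q.
  by apply: leq_trans (Lq _ pB); rewrite /uses -size_filter -(size_map fst) index_mem.
have q0 : 0 < q by apply: leq_ltn_trans iq.
exists (p.2 * q + index p.1 (l p.2)); first by nia.
rewrite divnMDl // divn_small // addn0 modnMDl modn_small // nth_index //.
by apply: ball_le xp; rewrite leq_addr.
Qed.

Section Asymptotics.
Local Open Scope ring_scope.
Variable R : realType.

(* The two terms are [B / eta] and [kap] for [eta = 1 / (100 kap)]. *)
Definition slack (E : nat) : nat :=
  (100 * (1600 * E).+1 * (10 * E).+2 + (1600 * E).+1)%N.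

Lemma balanced_radii (V : finType) (e : rel V) (E q m : nat) v t :
  symmetric e -> (50 <= E)%N -> (100 * (slack E + 3) <= q)%N ->
  rooted e v t -> (m <= (10 * E).+2 * q.+1)%N -> (4 * weight t <= 3 * m ^ 2)%N ->
  exists c : nat -> V, forall x, x \in v :: verts t ->
    exists2 r, (r < (10 * E).+2 * q)%N & x \in ball e (c r) r.
Proof.
move=> e_sym E50 qbig vt mq wm.
set kap := (1600 * E).+1; set B := (10 * E).+2.
have E0 : (0 < E)%N by lia.
have q0 : (0 < q)%N by lia.
have k0 : 0 < kap%:R :> R by rewrite ltr0n.
pose eta : R := (100 * kap%:R)^-1.
have eta0 : 0 < eta by rewrite invr_gt0 mulr_gt0.
have [L [LB Lc Lp]] := balanced_cover e_sym E0 q0 eta0 (fun=> 0%N) vt.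
have Lq b : (b < B)%N -> (uses L b <= q)%N.
  move=> bB; rewrite -(ler_nat R).
  have := Lp b bB; rewrite add0n.
  have -> : potential E eta (fun=> 0%N) = B%:R.
    rewrite /potential (eq_bigr (fun=> 1)) ?sumr_const ?card_ord // => i _.
    by rewrite /fire_price mulr0 expR0.
  have etak : eta * kap%:R = 100^-1 by rewrite /eta; field; rewrite gt_eqF.
  rewrite -/kap etak.
  set G := expR 100^-1; set W := (weight t)%:R; set Q := q%:R.
  have G99 : G <= 100 / 99.
    have := expR_ge1Dx (- 100^-1 : R); rewrite expRN -/G.
    have G0 : 0 < G by apply: expR_gt0.
    by rewrite -(ler_pM2r G0) mulVf ?gt_eqF //; lra.
  (* This crude bound moves the initial potential [B] into the exponent, where it costs [B / eta],
     independent of [q]. *)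
  have Bexp : B%:R <= expR (B%:R) :> R by apply: le_trans (expR_ge1Dx _); rewrite lerDr.
  move=> /le_trans/(_ (ler_wpM2r (expR_ge0 _) Bexp)).
  rewrite -expRD ler_expR => main.
  have Q0 : 0 < Q by rewrite ltr0n.
  have E0' : 0 < E%:R :> R by rewrite ltr0n.
  have E50' : 50 <= E%:R :> R by rewrite (ler_nat _ 50).
  (* Here [W <= 3/4 B^2 (Q + 1)^2], [B^2 <= 101 E^2] as [E >= 50], and [3/4 * 101 / 78 < 0.972];
     [Q + 3] absorbs [(Q + 1)^2 / Q]. *)
  have Wle : W / (78 * E%:R ^+ 2 * Q) <= 972/1000 * (Q + 3).
    rewrite ler_pdivrMr ?mulr_gt0 ?exprn_gt0 //.
    have wm' : 4 * W <= 3 * (B%:R * (Q + 1)) ^+ 2.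
      have : (4 * weight t <= 3 * (B * q.+1) ^ 2)%N.
        by apply: leq_trans wm _; rewrite leq_pmul2l // leq_sqr.
      by rewrite -(ler_nat R) 2!natrM natrX natrM -[in q.+1]addn1 natrD.
    have B101 : B%:R ^+ 2 <= 101 * E%:R ^+ 2 :> R.
      by rewrite /B -addn2 natrD natrM; nra.
    have Q1 : 1 <= Q by rewrite (ler_nat _ 1).
    have B2 := ler_wpM2r (sqr_ge0 (Q + 1)) B101.
    have Q2 : 303 * (Q + 1) ^+ 2 <= 4 * (972/1000 * (Q + 3)) * (78 * Q) by nra.
    have E2 := ler_wpM2l (sqr_ge0 E%:R) Q2.
    by rewrite exprMn in wm'; lra.
  have Qbig : 100 * ((100 * kap%:R * B%:R + kap%:R) + 3) <= Q.
    by move: qbig; rewrite -(ler_nat R) !natrM !natrD !natrM -/kap -/B.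
  have W0 : 0 <= W / (78 * E%:R ^+ 2 * Q) by rewrite divr_ge0 // !mulr_ge0 ?exprn_ge0 // ltW.
  have GW : G * (W / (78 * E%:R ^+ 2 * Q)) <= 100 / 99 * (972/1000 * (Q + 3)).
    by apply: ler_pM; rewrite ?expR_ge0.
  have : (uses L b)%:R <= B%:R / eta + G * (W / (78 * E%:R ^+ 2 * Q)) + kap%:R :> R.
    rewrite -(ler_pM2l eta0); apply: le_trans main _.
    rewrite le_eqVlt; apply/orP; left; apply/eqP.
    rewrite -etak; field.
    by rewrite !gt_eqF.
  (* As [100/99 * 972/1000 < 0.99], a slack of at most [Q / 100 - 3] still fits below [Q]. *)
  rewrite {1}/eta invrK; lra.
have [c cP] := @bins_to_radii _ e q B v L LB Lq.
by exists c => x /Lc/cP.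
Qed.

(** Take [q] as the quotient of [m - 1] by the number of bins. Stopping one radius short of [m]
    leaves the extra round for the leaves. *)
Lemma asymptotic_radii : exists N : nat, forall (V : finType) (e : rel V) m v t,
  symmetric e -> rooted e v t -> (N <= m)%N -> (4 * weight t <= 3 * m ^ 2)%N ->
  exists c : nat -> V, forall x, x \in v :: verts t ->
    exists2 r, (r.+1 < m)%N & x \in ball e (c r) r.
Proof.
have [E E50] : exists E, (50 <= E)%N by exists 50%N.
exists ((10 * E).+2 * (100 * (slack E + 3))).+1 => V e [|m] v t e_sym vt //.
rewrite ltnS => Nm wm; set B := (10 * E).+2 in Nm *.
have mB := divn_eq m B; have mmB : (m %% B < B)%N by rewrite ltn_mod.
have qbig : (100 * (slack E + 3) <= m %/ B)%N by rewrite leq_divRL // mulnC.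
have mq : (m.+1 <= B * (m %/ B).+1)%N by rewrite mulnS mulnC; lia.
have [c cP] := balanced_radii e_sym E50 qbig vt mq wm.
exists c => x /cP[r rB xr]; exists r => //.
by apply: leq_trans rB _; rewrite mulnC leq_divM.
Qed.
End Asymptotics.

(** * Counting in trees *)

Lemma rooted_graft (V : finType) (e : rel V) v t x y :
  rooted e v t -> x \in v :: verts t -> e x y ->
  exists2 t', rooted e v t' & perm_eq (verts t') (y :: verts t).
Proof.
move=> vt xt exy; elim: t v vt xt => [|z t IH|t1 IH1 t2 IH2] v vt.
- by rewrite inE => /eqP xv; exists (Edge y Bare) => //=; rewrite -xv exy.
- rewrite inE => /predU1P[xv|xt].
    exists (Glue (Edge y Bare) (Edge z t)) => //=.
    by rewrite -xv exy /=; move: vt; rewrite /= -xv.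
  have /andP[evz zt] : e v z && rooted e z t by [].
  have [t' r' p'] := IH z zt xt.
  exists (Edge z t'); first by rewrite /= evz.
  by rewrite /= -(cat1s y) -(cat1s z (verts t)) perm_sym perm_catCA /= perm_cons perm_sym.
- have /andP[vt1 vt2] : rooted e v t1 && rooted e v t2 by [].
  rewrite inE mem_cat orbA => /orP[xt|xt].
    have [t' r' p'] := IH1 v vt1 xt.
    exists (Glue t' t2); first by rewrite /= r'.
    by rewrite /= -cat_cons perm_cat2r.
  have [t' r' p'] := IH2 v vt2 (mem_behead (s := v :: _) xt).
  exists (Glue t1 t'); first by rewrite /= vt1.
  by rewrite /= -cat1s perm_sym perm_catCA perm_cat2l perm_sym.
Qed.

(** Repeatedly graft a missing vertex of least [d]: its parent is already in the tree. *)
Lemma spanning_rtree (V : finType) (e : rel V) (d : V -> nat) (A : {set V}) r :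
  r \in A ->
  (forall x, x \in A -> x != r -> exists2 y, y \in A & e y x && (d y < d x)) ->
  exists t, [/\ rooted e r t, {subset A <= r :: verts t} & weight t < #|A|].
Proof.
move=> rA par.
have grow k t : rooted e r t -> uniq (r :: verts t) -> {subset r :: verts t <= A} ->
    #|A| <= k + (weight t).+1 ->
    exists t', [/\ rooted e r t', {subset A <= r :: verts t'} & weight t' < #|A|].
  elim: k t => [|k IHk] t rt ut tA Ak.
    have ss : r :: verts t =i A.
      apply/subset_cardP; last exact/subsetP.
      apply/eqP; rewrite eqn_leq subset_leq_card /=; last exact/subsetP.
      by rewrite (card_uniqP ut).
    exists t; split=> // [x|]; first by rewrite ss.
    by rewrite -(eq_card ss) (card_uniqP ut).
  have [/existsP[x0 x0P]|] := boolP [exists x, (x \in A) && (x \notin r :: verts t)].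
    case: (@arg_minnP _ x0 [pred x | (x \in A) && (x \notin r :: verts t)] d x0P).
    move=> x /andP[xA xt] xmin.
    have xr : x != r by apply: contraNneq xt => ->; rewrite mem_head.
    have [y yA /andP[eyx dyx]] := par _ xA xr.
    have yt : y \in r :: verts t.
      by apply: contraLR dyx => yt; rewrite -leqNgt; apply: xmin; rewrite inE yA.
    have [t' rt' pt'] := rooted_graft rt yt eyx.
    have pr : perm_eq (r :: verts t') (x :: r :: verts t).
      by rewrite -(cat1s x) -(cat1s r (verts t)) perm_sym perm_catCA /= perm_cons perm_sym.
    apply: (IHk t') => //.
    - by rewrite (perm_uniq pr) /= xt.
    - by move=> z; rewrite (perm_mem pr) inE => /predU1P[->//|/tA].
    - have -> : weight t' = (weight t).+1 by apply: perm_size pt'.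
      by rewrite -addSnnS.
  rewrite negb_exists => /forallP all_in; exists t; split=> //.
    by move=> x xA; have := all_in x; rewrite xA negbK.
  by rewrite -[(weight t).+1](card_uniqP ut) subset_leq_card //; apply/subsetP.
apply: (grow #|A| Bare) => //; last by rewrite leq_addr.
by move=> x; rewrite inE => /eqP->.
Qed.

Section Trees.
Variables (T : finType) (e : rel T).
Hypothesis e_tree : tree e.

Let e_sym : symmetric e. Proof. by case: e_tree => [[]]. Qed.
Let e_irr : irreflexive e. Proof. by case: e_tree => [[]]. Qed.

Lemma tree_depth r : exists d : T -> nat,
  forall x, x != r -> exists2 y, e y x & d y < d x.
Proof.
have reach x : exists k, x \in ball e r k.
  have [_ _ /(_ r x)/connectP[p ep ->] _] := e_tree.
  elim/last_ind: p ep => [|p y IHp]; first by exists 0; rewrite ball_id.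
  rewrite rcons_path last_rcons => /andP[/IHp[k rk] ey].
  by exists k.+1; apply: ball_edge rk _ ey.
exists (fun x => ex_minn (reach x)) => x xr.
case: ex_minnP => -[|k] xk kmin.
  by move: xk; rewrite inE (negbTE xr).
case/ballS_parent: xk => [/kmin|[y yk eyx]]; first by rewrite ltnn.
by exists y => //; case: ex_minnP => l _ /(_ _ yk).
Qed.

Section Depth.
Variables (r : T) (d : T -> nat).
Hypothesis d_parent : forall x, x != r -> exists2 y, e y x & d y < d x.

(* Distinct [y] and [z] would be joined by a path through the root that avoids
   [x], closing a cycle. *)
Lemma low_neighbour_uniq x y z :
  e x y -> e x z -> d y <= d x -> d z <= d x -> y = z.
Proof.
move=> exy exz dyx dzx; apply/eqP; apply: contraT => yz.
pose f := [rel a b | [&& e a b, a != x & b != x]].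
have f_sym : symmetric f by move=> a b; rewrite /= e_sym; congr (_ && _); rewrite andbC.
(* Climbing to parents strictly lowers [d] from a value at most [d x], so it never meets [x]. *)
have to_root a : d a <= d x -> a != x -> connect f a r.
  have [n] := ubnP (d a); elim: n a => // n IHn a an dax ax.
  have [->//|ar] := eqVneq a r.
  have [b eba dba] := d_parent ar.
  have bx : b != x by apply: contraTneq dba => ->; rewrite -leqNgt.
  apply: connect_trans (connect1 _) (IHn b _ _ bx); first by rewrite /= e_sym eba ax.
    by apply: leq_trans dba _.
  exact: ltnW (leq_trans dba dax).
have neq a : e x a -> a != x by apply: contraTneq => ->; rewrite e_irr.
have : connect f y z.
  apply: connect_trans (to_root y dyx (neq _ exy)) _.
  by rewrite (sym_connect_sym f_sym) to_root ?neq.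
case/connectP=> p0 /shortenP[p fp up _] zp.
have epx : path e y p && (x \notin y :: p).
  have : path e y p by apply: sub_path fp => a b /and3P[].
  move=> ->; rewrite inE negb_or eq_sym neq //=.
  elim: (p) (y) fp => //= b p' IHp a /andP[/and3P[_ _ bx] /IHp].
  by rewrite inE negb_or eq_sym bx.
have cyc : ucycle e (x :: y :: p).
  rewrite /ucycle /ucycleb /= exy rcons_path; move: epx => /andP[-> xp].
  by rewrite -zp e_sym exz xp.
have [_ _ _ acyc] := e_tree.
(* A cycle [x :: y :: p] of size at most 2 forces [p] to be empty, so [z = y]. *)
have := acyc _ cyc; case: (p) zp => //= zy; by rewrite zy eqxx in yz.
Qed.

Lemma parent_nonleaf x y : ~~ leaf e r -> e y x -> d y < d x -> ~~ leaf e y.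
Proof.
move=> rN eyx dyx; have [->//|/d_parent[z ezy dzy]] := eqVneq y r.
have zx : z != x by apply: contraTneq (ltn_trans dzy dyx) => ->; rewrite ltnn.
suff: 1 < degree e y by rewrite /leaf; case: (degree e y) => [|[]].
by apply/card_gt1P; exists z, x; rewrite !inE e_sym.
Qed.

(** Charge each edge to an endpoint at least as deep as the other; by [low_neighbour_uniq] each
    vertex is charged at most once. *)
Lemma sum_degree_le : \sum_x degree e x <= 2 * #|T|.
Proof.
pose low x y := e x y && (d y <= d x).
have low1 x : \sum_y low x y <= 1.
  rewrite -big_mkcond /= sum1_card leqNgt; apply/card_gt1P => -[y [z []]].
  rewrite !unfold_in => /andP[exy dyx] /andP[exz dzx].
  by rewrite (low_neighbour_uniq exy exz dyx dzx) eqxx.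
have degE x : degree e x <= \sum_y low x y + \sum_y low y x.
  rewrite -big_split /= /degree cardsE -sum1_card big_mkcond leq_sum // => y _.
  rewrite /low [e y x]e_sym unfold_in.
  by case: (e x y) => //=; case/orP: (leq_total (d y) (d x)) => -> //; rewrite addn1.
apply: (@leq_trans (\sum_x (\sum_y low x y + \sum_y low y x))).
  by apply: leq_sum => x _; apply: degE.
rewrite big_split /= [X in _ + X]exchange_big /= addnn -mul2n leq_pmul2l //.
by rewrite -sum1_card; apply: leq_sum => x _; apply: low1.
Qed.
End Depth.

Lemma degree_gt0 x : 1 < #|T| -> 0 < degree e x.
Proof.
case/card_gt1P=> y [z [_ _ yz]].
have [w wx] : exists w, w != x.
  by have [<-|] := eqVneq y x; [exists z; rewrite eq_sym | exists y].
have [d dP] := tree_depth w.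
have xw : x != w by rewrite eq_sym.
have [u eux _] := dP x xw.
by apply/card_gt0P; exists u; rewrite inE e_sym.
Qed.

(** A leaf has degree 1 and any other vertex at least [2 + (degree - 3)], with truncated
    subtraction. Comparing with [2 * #|T|], the total excess is at most the number of leaves, so the
    non-leaves number less than three times the leaves. *)
Lemma few_nonleaves :
  1 < #|T| -> n_nonleaf e < 3 * \sum_x (degree e x - 3) -> 4 * n_nonleaf e < 3 * #|T|.
Proof.
move=> T1 big.
have [r _] : exists r : T, r \in T by apply/card_gt0P/ltnW.
have [d dP] := tree_depth r; have := sum_degree_le dP.
have cT : n_nonleaf e + \sum_x leaf e x = #|T|.
  rewrite -sum1_card /n_nonleaf -sum1_card !big_mkcond -big_split /=.
  by apply: eq_bigr => x _; rewrite inE; case: leaf.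
have : \sum_x (leaf e x + ~~ leaf e x + ~~ leaf e x + (degree e x - 3)) <= \sum_x degree e x.
  apply: leq_sum => x _; have := degree_gt0 x T1; rewrite /leaf.
  by case: eqP => /=; lia.
have nE : n_nonleaf e = \sum_x ~~ leaf e x.
  rewrite /n_nonleaf -sum1_card big_mkcond; apply: eq_bigr => x _.
  by rewrite inE; case: leaf.
rewrite !big_split /= -nE; move: big cT.
move: (\sum_x (degree e x - 3)) (\sum_x leaf e x : nat) (\sum_x degree e x) => S l d'.
move: #|T| (n_nonleaf e) => k n; clear; lia.
Qed.
End Trees.

(** Each radius is raised by one, so that a ball covering the parent of a leaf, itself not a leaf,
    also covers the leaf. *)
Lemma burning_number_le_nonleaf (T : finType) (e : rel T) m (c : nat -> T) r t :
  tree e -> ~~ leaf e r -> {subset [set x | ~~ leaf e x] <= r :: verts t} ->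
  (forall x, x \in r :: verts t -> exists2 k, k.+1 < m & x \in ball e (c k) k) ->
  burning_number e <= m.
Proof.
move=> e_tree rN tP cP; apply: (burning_number_le (c := fun k => c k.-1)) => x.
have [d dP] := tree_depth e_tree r.
have [xl|xN] := boolP (leaf e x); last first.
  have [|k km xk] := cP x; first by apply: tP; rewrite inE.
  by exists k.+1 => //=; apply: ball_le xk.
have xr : x != r by apply: contraTneq xl => ->.
have [y eyx dyx] := dP x xr.
have [|k km yk] := cP y; first by apply: tP; rewrite inE (parent_nonleaf e_tree dP rN eyx).
by exists k.+1 => //=; apply: ball_edge yk _ eyx.
Qed.

(** Rooted at a non-leaf, the non-leaves are closed under parents, so they span a rooted tree. *)
Lemma burning_number_asymptotic (R : realType) :
  exists N : nat, forall (T : finType) (e : rel T) m,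
    tree e -> N <= m -> 0 < n_nonleaf e -> 4 * n_nonleaf e <= 3 * m ^ 2 ->
    burning_number e <= m.
Proof.
have [N NP] := asymptotic_radii R; exists N => T e m e_tree Nm.
move=> /card_gt0P[r]; rewrite inE => rN nm.
have [d dP] := tree_depth e_tree r.
have e_sym : symmetric e by case: e_tree => [[]].
have [|x _ xr|t [rt tP tw]] := @spanning_rtree T e d [set x | ~~ leaf e x] r.
- by rewrite inE.
- have [y eyx dyx] := dP x xr.
  by exists y; rewrite ?eyx // inE (parent_nonleaf e_tree dP rN eyx).
have [|c cP] := NP T e m r t e_sym rt Nm.
  by apply: leq_trans nm; rewrite leq_pmul2l // ltnW.
exact: burning_number_le_nonleaf e_tree rN tP cP.
Qed.

(** * From concentrations to the total excess degree *)

Section Concentrations.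
Local Open Scope ring_scope.
Variables (R : realType) (T : finType) (e : rel T).
Hypothesis nonleaf_gt0 : (0 < n_nonleaf e)%N.

Let n0 : 0 < (n_nonleaf e)%:R :> R. Proof. by rewrite ltr0n. Qed.

Lemma concentration_excess :
  \sum_(4 <= k < #|T|) (k - 3)%:R * concentration R e k > 1 / 3 ->
  (n_nonleaf e < 3 * \sum_x (degree e x - 3))%N.
Proof.
move=> big; rewrite -(ltr_nat R).
have le : (\sum_(4 <= k < #|T|) (k - 3) * n_deg e k <= \sum_x (degree e x - 3))%N.
  have nE k : ((k - 3) * n_deg e k = \sum_(x | degree e x == k) (degree e x - 3))%N.
    rewrite mulnC /n_deg cardsE -sum_nat_const.
    by apply: eq_big => x; rewrite ?unfold_in // => /eqP->.
  under eq_bigr => k _ do rewrite nE big_mkcond.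
  rewrite exchange_big /=; apply: leq_sum => x _.
  rewrite -big_mkcond /= big_const_seq iter_addn_0 -[leqRHS]muln1 leq_mul2l.
  apply/orP; right; rewrite (eq_count (a2 := pred1 (degree e x))).
    by rewrite count_uniq_mem ?iota_uniq // leq_b1.
  by move=> k; rewrite /= eq_sym.
move: le; rewrite -(ler_nat R) natr_sum => le.
have sumE : \sum_(4 <= k < #|T|) (k - 3)%:R * concentration R e k =
    (\sum_(4 <= k < #|T|) ((k - 3) * n_deg e k)%:R) / (n_nonleaf e)%:R.
  by rewrite mulr_suml; apply: eq_bigr => k _; rewrite /concentration mulrA natrM.
by move: big; rewrite sumE ltr_pdivlMr // natrM; lra.
Qed.

(** Each vertex of degree at least [k] contributes at least [k - 3] to the excess. *)
Lemma concentration_ge_excess k : (4 <= k)%N ->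
  concentration_ge R e k > 1 / (3 * (k - 3)%:R) ->
  (n_nonleaf e < 3 * \sum_x (degree e x - 3))%N.
Proof.
move=> k4; rewrite /concentration_ge => big; rewrite -(ltr_nat R) natrM.
have k3 : 0 < (k - 3)%:R :> R by rewrite ltr0n subn_gt0.
have le : ((k - 3) * n_deg_ge e k <= \sum_x (degree e x - 3))%N.
  rewrite mulnC /n_deg_ge cardsE -sum_nat_const.
  rewrite big_mkcond; apply: leq_sum => x _; rewrite unfold_in.
  by case: ifP => // kx; rewrite leq_sub2r.
move: le; rewrite -(ler_nat R) natrM => le.
move: big; rewrite ltr_pdivlMr // mul1r mulrC ltr_pdivrMr ?mulr_gt0 // => big.
lra.
Qed.
End Concentrations.

Local Open Scope ring_scope.

Lemma well_burnable_of_sqr (R : realType) (T : finType) (e : rel T) (m : nat) :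
  (burning_number e <= m.+1)%N -> (m ^ 2 < #|T|)%N -> well_burnable R e.
Proof.
move=> bm mT; rewrite /well_burnable.
suff : m%:Z < Num.ceil (Num.sqrt (#|T|%:R : R)) by lia.
rewrite ceil_gt_int -pmulrn -[ltLHS]ger0_norm // -sqrtr_sqr ltr_sqrt.
  by rewrite -natrX ltr_nat.
by rewrite ltr0n (leq_ltn_trans _ mT).
Qed.

Theorem theorem11 (R : realType) :
  exists N : nat, forall (T : finType) (e : rel T),
    tree e -> (N <= n_nonleaf e)%N ->
    (\sum_(4 <= k < #|T|) (k - 3)%:R * concentration R e k > 1 / 3 ->
       well_burnable R e) /\
    ((exists k : nat, (4 <= k)%N /\
        concentration_ge R e k > 1 / (3 * (k - 3)%:R)) ->
       well_burnable R e).
Proof.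
(* The square yields [N <= m.+1] from [N ^ 2 <= #|T| <= m.+1 ^ 2]; the added 2 excludes trees with
   fewer than two vertices. *)
have [N NP] := burning_number_asymptotic R; exists (N ^ 2 + 2)%N => T e e_tree Nn.
have n0 : (0 < n_nonleaf e)%N by lia.
have nT : (n_nonleaf e <= #|T|)%N by apply: max_card.
suff main : (n_nonleaf e < 3 * \sum_x (degree e x - 3))%N -> well_burnable R e.
  split=> [/concentration_excess|[k [k4 /concentration_ge_excess]]] H; apply: main.
    exact: H.
  exact: H.
have T1 : (1 < #|T|)%N by lia.
move=> /(few_nonleaves e_tree T1) nT4.
have Tm : exists m, (#|T| <= m.+1 ^ 2)%N.
  by exists #|T|; rewrite -mulnn (leq_trans _ (leq_pmull _ _)).
(* Minimality gives [m ^ 2 < #|T| <= m.+1 ^ 2], so [m.+1] is the target number of rounds. *)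
case: (ex_minnP Tm) => m mT mmin; apply: (@well_burnable_of_sqr _ _ _ m).
  apply: NP => //; last by lia.
  by rewrite -leq_sqr; apply: leq_trans mT; lia.
case: m mT mmin => [|m] _ mmin; first exact: ltnW.
by rewrite ltnNge; apply/negP => /mmin; rewrite ltnn.
Qed.
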